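(* Let $M_1$ and $M_2$ be two finite monoids with groups of units $U_1$ and $U_2$. If $D(U_1\times U_2)\neq 0$, then $$N(M_1\times M_2)\le \bigl(N(M_1)+N(M_2)\bigr)\,D(U_1\times U_2).$$ Furthermore, if $\mathrm{rank}(U_1\times U_2)=\mathrm{rank}(U_1)+\mathrm{rank}(U_2)$, and also in the case $D(U_1\times U_2)=0$, then $$N(M_1\times M_2)\le N(M_1)+N(M_2).$$
   Context: A generating set of a finite semigroup $S$ is a non-empty subset $A\subseteq S$ such that every element of $S$ is a product of one or more elements of $A$; $\mathrm{rank}(S)$ is the smallest cardinality of a generating set (so the trivial group has rank $1$). This applies in particular to monoids and groups, which are regarded as semigroups. For a generating set $A$ and $s\in S$, the length $l_A(s)$ is the least $k$ such that $s=a_1\cdots a_k$ with $a_i\in A$, except that the identity element of $S$ (if there is one) has length $0$ by convention. $\ker(S)$ is the minimum ideal of $S$, $N(S,A)=\min\{l_A(s): s\in\ker(S)\}$, and $N(S)$ is the minimum of $N(S,A)$ over all generating sets $A$ with $|A|=\mathrm{rank}(S)$. For a finite group $G$ with generating set $A$, $\mathrm{diam}(G,A)=\max\{l_A(g): g\in G\}$, and $D(G)$ denotes the minimum of $\mathrm{diam}(G,A)$ over all generating sets $A$ of $G$ of minimum size $\mathrm{rank}(G)$. *)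

(* Defs.v *)
From HB Require Import structures.
From mathcomp Require Import all_boot.
From mathcomp Require Import boolp.

Set Implicit Arguments.
Unset Strict Implicit.
Unset Printing Implicit Defensive.

Local Open Scope group_scope.

(* Finite groups are redeclared because Hierarchy Builder does not allow a    *)
(* class of finite semigroups below the existing finGroupType; the            *)
(* declarations below fail once fingroup.v has been loaded.                   *)
#[short(type="finSemigroupType")]
HB.structure Definition FinSemigroup := { S of Semigroup S & Finite S }.

#[short(type="finMonoidType")]
HB.structure Definition FinMonoid := { M of Monoid M & Finite M }.

#[short(type="finiteGroupType")]
HB.structure Definition FiniteGroup := { G of Group G & Finite G }.

HB.instance Definition _ (S T : finSemigroupType) := Semigroup.on (S * T)%type.
HB.instance Definition _ (M N : finMonoidType) := Monoid.on (M * N)%type.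
HB.instance Definition _ (G H : finiteGroupType) := Group.on (G * H)%type.

(* The least n such that P n holds; it is only meant for satisfiable P, and   *)
(* is 0 when no n satisfies P.                                                *)
Definition least (P : nat -> Prop) : nat :=
  if pselect (exists n, `[< P n >]) is left exP then ex_minn exP else 0.

Lemma leastP (P : nat -> Prop) :
  (exists n, P n) -> P (least P) /\ forall n, P n -> least P <= n.
Proof.
move=> [n Pn]; rewrite /least; case: pselect => [exP|[]]; last first.
  by exists n; apply/asboolP.
case: ex_minnP => m /asboolP Pm min_m; split=> // k Pk.
by apply/min_m/asboolP.
Qed.

Section FiniteSemigroups.
Variable S : finSemigroupType.
Implicit Types (A I : {set S}) (s e : S).

(* s is a product of k elements of A; no s is a product of 0 elements. *)
Definition is_product A (k : nat) s : Prop :=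
  exists a w, [/\ size (a :: w) = k, {subset a :: w <= A} & foldl *%g a w = s].

Definition generating A : Prop :=
  A != set0 /\ forall s, exists k, is_product A k s.

Definition rank : nat := least (fun n => exists2 A, generating A & #|A| = n).

Definition is_identity e : Prop := left_id e *%g /\ right_id e *%g.

Definition len A s : nat :=
  if `[< is_identity s >] then 0 else least (fun k => is_product A k s).

Definition ideal I : bool :=
  (I != set0) && [forall x in I, forall s, (s * x \in I) && (x * s \in I)].

(* The minimum ideal; see kernel_ideal and kernel_min below. *)
Definition kernel : {set S} := \bigcap_(I | ideal I) I.

(* N(S, A) *)
Definition ker_length A : nat :=
  least (fun n => exists2 s, s \in kernel & len A s = n).

(* N(S) *)
Definition min_ker_length : nat :=
  least (fun n => exists A, [/\ generating A, #|A| = rank & ker_length A = n]).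

End FiniteSemigroups.

Arguments rank S : clear implicits.
Arguments kernel S : clear implicits.
Arguments min_ker_length S : clear implicits.

Lemma setT_generating (S : finSemigroupType) (s0 : S) : generating [set: S].
Proof.
split; first by apply/set0Pn; exists s0; rewrite inE.
by move=> s; exists 1%N, s, [::]; split=> // x _; rewrite inE.
Qed.

Lemma kernel_min (S : finSemigroupType) (I : {set S}) :
  ideal I -> kernel S \subset I.
Proof. exact: bigcap_inf. Qed.

Lemma kernel_ideal (S : finSemigroupType) (s0 : S) : ideal (kernel S).
Proof.
apply: (big_ind (@ideal S)) => // [|I J /andP[I0 /'forall_implyP Iid]
                                        /andP[J0 /'forall_implyP Jid]].
  apply/andP; split; first by apply/set0Pn; exists s0; rewrite inE.
  by apply/'forall_implyP => x _; apply/forallP => s; rewrite !inE.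
have [[x Ix] [y Jy]] := (set0Pn _ I0, set0Pn _ J0).
apply/andP; split.
  apply/set0Pn; exists (x * y); rewrite inE.
  have /forallP/(_ y)/andP[_ ->] := Iid _ Ix.
  by have /forallP/(_ x)/andP[-> _] := Jid _ Jy.
apply/'forall_implyP => z /setIP[Iz Jz]; apply/forallP => s; rewrite !inE.
have /forallP/(_ s)/andP[-> ->] := Iid _ Iz.
by have /forallP/(_ s)/andP[-> ->] := Jid _ Jz.
Qed.

Definition diam (G : finiteGroupType) (A : {set G}) : nat := \max_(g : G) len A g.

(* D(G) *)
Definition min_diam (G : finiteGroupType) : nat :=
  least (fun n => exists A : {set G},
    [/\ generating A, #|A| = rank G & diam A = n]).

Section Units.
Variable M : finMonoidType.

Definition is_unit (x : M) : bool := [exists y, (x * y == 1) && (y * x == 1)].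

Definition units := {x : M | is_unit x}.

HB.instance Definition _ := SubFinite.on units.

Fact is_unit_monoid_closed : monoid_closed is_unit.
Proof.
split=> [|x y]; first by apply/existsP; exists 1; rewrite mulg1 eqxx.
move=> /existsP[x' /andP[/eqP xx' /eqP x'x]].
move=> /existsP[y' /andP[/eqP yy' /eqP y'y]].
apply/existsP; exists (y' * x').
rewrite -mulgA (mulgA y) yy' mul1g xx' eqxx.
by rewrite -mulgA (mulgA x') x'x mul1g y'y eqxx.
Qed.

HB.instance Definition _ :=
  SubChoice_isSubMonoid.Build M is_unit units is_unit_monoid_closed.

Fact unit_inv_subproof (u : units) :
  exists v : units, (u * v == 1) && (v * u == 1).
Proof.
case: u => x xU; have [y /andP[xy yx]] := existsP xU.
have yU : is_unit y by apply/existsP; exists x; rewrite xy yx.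
by exists (Sub y yU); rewrite -!val_eqE /= xy yx.
Qed.

Definition unit_inv (u : units) : units := xchoose (unit_inv_subproof u).

Fact unit_mulVg : left_inverse 1 unit_inv *%g.
Proof. by move=> u; have /andP[_ /eqP] := xchooseP (unit_inv_subproof u). Qed.

Fact unit_mulgV : right_inverse 1 unit_inv *%g.
Proof. by move=> u; have /andP[/eqP] := xchooseP (unit_inv_subproof u). Qed.

HB.instance Definition _ := hasInv.Build units unit_inv.
HB.instance Definition _ := Monoid_isGroup.Build units unit_mulVg unit_mulgV.

End Units.

(* Main.v *)
Require Import Defs.
From HB Require Import structures.
From mathcomp Require Import all_boot.
From mathcomp Require Import boolp.

(** In a finite monoid M a product is a unit only if all its factors are, so
    the non-units form an ideal. Hence a generating set A consists of a
    generating set of the group of units U and of non-units which, together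
    with U, generate M; the two parts can be chosen independently, so that
    rank M = rank U + r(M), where r(M) counts the non-units of a minimal
    generating set.

    The number r is additive on direct products. If A generates M1 x M2, then
    writing (x, 1) as a product of elements of A uses only elements whose second
    coordinate is a unit; so the elements of A of the form (non-unit, unit)
    provide enough non-units to generate M1 over its units, and symmetrically
    for (unit, non-unit). These two families are disjoint, which gives
    [rank_prod_ge]. Consequently, if A1 and A2 are minimal generating sets with
    non-units Y1 and Y2, and X is any minimal generating set of U1 x U2, then
    the union of X, Y1 x {1} and {1} x Y2 is a minimal generating set of
    M1 x M2 ([joined_minimal]).

    Take A1 and A2 together with shortest words for elements k1 and k2 of the
    two kernels such that N(M1) and N(M2) are attained. The pair (k1, k2) lies
    in the kernel of the product, and it equals (k1, 1) (1, k2). Spelling both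
    factors letter by letter, a non-unit letter costs one generator and a unit
    letter costs its length over X, hence at most any c >= 1 bounding these
    lengths ([min_ker_length_prod_le]). Three choices of X and c give the
    theorem: a minimal X attaining D(U1 x U2), with c = D(U1 x U2), or with
    c = 1 when D(U1 x U2) = 0; and, when the rank is additive on the groups of
    units, the union of U1 :&: A1 and U2 :&: A2 placed on the two axes, which
    is then minimal and for which c = 1. *)

Set Implicit Arguments.
Unset Strict Implicit.
Unset Printing Implicit Defensive.

Local Open Scope group_scope.

(** * Least values and products in a finite semigroup *)

Lemma least_holds (P : nat -> Prop) n : P n -> P (least P).
Proof. by move=> Pn; have [] : _ /\ _ := leastP (ex_intro P n Pn). Qed.

Lemma least_le (P : nat -> Prop) n : P n -> least P <= n.
Proof. by move=> Pn; have [_] : _ /\ _ := leastP (ex_intro P n Pn); apply. Qed.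

Section Products.
Variable S : finSemigroupType.
Implicit Types (A B : {set S}) (s x y a : S).

Lemma is_product1 A a : a \in A -> is_product A 1 a.
Proof. by move=> Aa; exists a, [::]; split=> // x; rewrite inE => /eqP->. Qed.

Lemma is_productS A k x a : is_product A k x -> a \in A -> is_product A k.+1 (x * a).
Proof.
move=> [b [w [<- sub <-]]] Aa; exists b, (rcons w a); split.
- by rewrite /= size_rcons.
- by move=> y; rewrite -rcons_cons mem_rcons inE => /predU1P[-> //|/sub].
- by rewrite foldl_rcons.
Qed.

(** Words grow at their right end. Together with [is_product1] and
    [is_productS], this principle spares any further inspection of words. *)
Lemma is_product_ind A (P : nat -> S -> Prop) :
    (forall a, a \in A -> P 1%N a) ->
    (forall k x a, a \in A -> P k x -> P k.+1 (x * a)) ->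
  forall k s, is_product A k s -> P k s.
Proof.
move=> P1 PS k s [a [w [<- sub <-]]].
elim/last_ind: w sub => [|w b IHw] sub; first by apply/P1/sub/mem_head.
rewrite /= size_rcons foldl_rcons; apply: PS.
  by apply: sub; rewrite -rcons_cons mem_rcons mem_head.
by apply: IHw => y wy; apply: sub; rewrite -rcons_cons mem_rcons inE wy orbT.
Qed.

Lemma is_productM A j k x y :
  is_product A j x -> is_product A k y -> is_product A (j + k) (x * y).
Proof.
move=> jx; elim/is_product_ind: k y / => [a Aa|k y a Aa IH].
  by rewrite addn1; apply: is_productS.
by rewrite addnS mulgA; apply: is_productS.
Qed.

Definition generated A s := exists k, is_product A k s.

Lemma generated_mem A a : a \in A -> generated A a.
Proof. by exists 1%N; apply: is_product1. Qed.

Lemma generatedM A x y : generated A x -> generated A y -> generated A (x * y).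
Proof. by move=> [j jx] [k ky]; exists (j + k)%N; apply: is_productM. Qed.

(** The length-free form of [is_product_ind], used wherever only the existence
    of a product matters. *)
Lemma generated_ind A (P : S -> Prop) :
    (forall a, a \in A -> P a) -> (forall x a, a \in A -> P x -> P (x * a)) ->
  forall s, generated A s -> P s.
Proof.
move=> P1 PS s [k]; move: k s; apply: is_product_ind => // k x a; exact: PS.
Qed.

Lemma generated_neq0 A s : generated A s -> A != set0.
Proof. by move: s; apply: generated_ind => // a Aa; apply/set0Pn; exists a. Qed.

Lemma rank_le A : generating A -> rank S <= #|A|.
Proof. by move=> genA; rewrite /rank; apply: least_le; exists A. Qed.

Definition minimal_generating A := generating A /\ #|A| = rank S.

Lemma minimal_generating_ex s0 : exists A, minimal_generating A.
Proof.
have [A genA cardA] : exists2 A : {set S}, generating A & #|A| = rank S.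
  apply: (@least_holds (fun n => exists2 A, generating A & #|A| = n) #|[set: S]|).
  by exists [set: S] => //; apply: setT_generating.
by exists A.
Qed.

Lemma min_ker_length_le A s :
  minimal_generating A -> s \in kernel S -> min_ker_length S <= len A s.
Proof.
move=> [genA cardA] Ks; apply: (@leq_trans (ker_length A)).
  by rewrite /min_ker_length; apply: least_le; exists A.
by rewrite /ker_length; apply: least_le; exists s.
Qed.

Lemma min_ker_length_attained s0 :
  exists A s, [/\ minimal_generating A, s \in kernel S & len A s = min_ker_length S].
Proof.
have [B [genB cardB]] := minimal_generating_ex s0.
have [A [genA cardA kerA]] : exists A : {set S},
    [/\ generating A, #|A| = rank S & ker_length A = min_ker_length S].
  apply: (@least_holds (fun n => exists A,
    [/\ generating A, #|A| = rank S & ker_length A = n]) (ker_length B)).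
  by exists B.
have /andP[/set0Pn[k Kk] _] := kernel_ideal s0.
have [s Ks lens] : exists2 s, s \in kernel S & len A s = ker_length A.
  apply: (@least_holds (fun n => exists2 s, s \in kernel S & len A s = n) (len A k)).
  by exists k.
by exists A, s; split=> //; rewrite lens.
Qed.

End Products.

(** Substitution of words for letters; with [f] the identity it says that
    generation is transitive. *)
Lemma generated_morph (S T : finSemigroupType) (f : S -> T) (A : {set S})
    (B : {set T}) :
    {morph f : x y / x * y} -> {in A, forall a, generated B (f a)} ->
  forall s, generated A s -> generated B (f s).
Proof.
move=> fM AB; apply: generated_ind => // x a /AB Ba Bx.
by rewrite fM; apply: generatedM.
Qed.

(** * Lengths and units in a finite monoid *)

Section Monoids.
Variable M : finMonoidType.
Implicit Types (A : {set M}) (s x y a : M).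

Lemma generated_generating A : (forall s, generated A s) -> generating A.
Proof. by move=> genA; split=> //; apply: generated_neq0 (genA 1). Qed.

Lemma is_identityE x : is_identity x <-> x = 1.
Proof.
split=> [[+ _] |->]; first by move/(_ 1); rewrite mulg1.
by split=> y; rewrite ?mul1g ?mulg1.
Qed.

Lemma len1 A : len A 1 = 0.
Proof. by rewrite /len; case: asboolP => // -[]; apply/is_identityE. Qed.

Lemma len_is_product A k s : is_product A k s -> len A s <= k.
Proof. by rewrite /len; case: asboolP => // _; apply: least_le. Qed.

Lemma is_product_len A s : generating A -> s <> 1 -> is_product A (len A s) s.
Proof.
move=> [_ genA] s1; rewrite /len; case: asboolP => [/is_identityE //|_].
by have [k /(@least_holds (fun k => is_product A k s))] := genA s.
Qed.

Lemma len_mem A a : a \in A -> len A a <= 1.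
Proof. by move=> /is_product1/len_is_product. Qed.

(** The convention that the identity has length 0 matches the empty word, so
    subadditivity holds without exception. *)
Lemma lenM A x y : generating A -> len A (x * y) <= len A x + len A y.
Proof.
move=> genA.
have [->|/eqP x1] := eqVneq x 1; first by rewrite mul1g leq_addl.
have [->|/eqP y1] := eqVneq y 1; first by rewrite mulg1 leq_addr.
by apply/len_is_product/is_productM; apply: is_product_len.
Qed.

(** Left multiplication by [z] is injective since [x] undoes it, hence
    surjective by finiteness: [z] has a right inverse, which must be [x]. *)
Lemma inverse_sym x z : x * z = 1 -> z * x = 1.
Proof.
move=> xz.
have zI : injective [eta *%g z].
  by move=> s t /(congr1 [eta *%g x]) /=; rewrite !mulgA xz !mul1g.
have zt : z * invF zI 1 = 1 := f_invF zI 1.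
suff -> : x = invF zI 1 by [].
by rewrite -[LHS]mulg1 -[in LHS]zt mulgA xz mul1g.
Qed.

Lemma is_unitP x : reflect (exists y, x * y = 1) (is_unit x).
Proof.
apply: (iffP existsP) => [[y /andP[/eqP xy _]]|[y xy]]; exists y => //.
by rewrite xy (inverse_sym xy) !eqxx.
Qed.

(** One-sided inverses suffice in a finite monoid, and a right inverse of
    [x * y] yields a right inverse of [x] and a left inverse of [y]. *)
Lemma is_unitM x y : is_unit (x * y) = is_unit x && is_unit y.
Proof.
apply/idP/andP => [/is_unitP[z xyz]|[xU yU]]; last first.
  by have [_] := is_unit_monoid_closed M; apply.
have xyz1 : x * (y * z) = 1 by rewrite mulgA.
split; apply/is_unitP; first by exists (y * z).
by exists (z * x); rewrite mulgA (inverse_sym xyz1).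
Qed.

Definition unit_set : {set M} := [set x | is_unit x].

End Monoids.

Arguments unit_set M : clear implicits.

(** If each letter of [A] has a word of length at most [c], a shortest word for
    [s] can be rewritten letter by letter; [f 1 = 1] handles the empty word. *)
Lemma len_morph (M N : finMonoidType) (f : M -> N) (A : {set M}) (B : {set N}) c s :
    {morph f : x y / x * y} -> f 1 = 1 -> generating A -> generating B ->
    {in A, forall a, len B (f a) <= c} ->
  len B (f s) <= (len A s * c)%N.
Proof.
move=> fM f1 genA genB Ac.
have [->|/eqP s1] := eqVneq s 1; first by rewrite f1 len1.
have := is_product_len genA s1; move: (len A s) => k; move: k s {s1}.
apply: is_product_ind => [a /Ac|k x a /Ac Bac Bx]; first by rewrite mul1n.
by rewrite fM mulSnr; apply: leq_trans (lenM _ _ genB) (leq_add Bx Bac).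
Qed.

Lemma min_diam_attained (G : finiteGroupType) :
  exists2 X : {set G}, minimal_generating X & diam X = min_diam G.
Proof.
have [B [genB cardB]] := minimal_generating_ex (1 : G).
have [X [genX cardX diamX]] : exists X : {set G},
    [/\ generating X, #|X| = rank G & diam X = min_diam G].
  apply: (@least_holds (fun n => exists X : {set G},
    [/\ generating X, #|X| = rank G & diam X = n]) (diam B)).
  by exists B.
by exists X.
Qed.

(** * Splitting a generating set into units and non-units *)

(** The group of units is represented by any injective morphism [phi] whose
    image is the set of units. This covers both the units of a monoid and the
    pairs of units of two monoids, which are the units of the product. *)
Section UnitEmbedding.
Variables (G M : finMonoidType) (phi : G -> M).
Hypotheses (phiM : {morph phi : u v / u * v}) (phi_inj : injective phi).
Hypothesis phi_units : forall x, reflect (exists u, phi u = x) (is_unit x).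

(** A word over [A] whose value is a unit has only units as letters, so it can
    be pulled back through [phi]. *)
Lemma generating_preim_units (A : {set M}) :
  generating A -> generating (phi @^-1: A).
Proof.
move=> [_ genA]; apply: generated_generating => g.
have: forall u, phi u = phi g -> generated (phi @^-1: A) u; last exact.
have := genA (phi g).
move: (phi g); apply: generated_ind => [a Aa u ua|x a Aa IHx u uxa].
  by apply: generated_mem; rewrite inE ua.
have /phi_units : exists u, phi u = x * a by exists u.
rewrite is_unitM => /andP[/phi_units[v vx] /phi_units[w wa]].
have ->: u = v * w by apply: phi_inj; rewrite phiM vx wa.
by apply: generatedM; [apply: IHx | apply: generated_mem; rewrite inE wa].
Qed.

Lemma card_preim_units (A : {set M}) : #|phi @^-1: A| = #|A :&: unit_set M|.
Proof.
rewrite -(card_imset _ phi_inj); apply: eq_card => x; rewrite !inE.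
apply/imsetP/andP => [[u]|[Ax /phi_units[u ux]]].
  by rewrite inE => Au ->; split=> //; apply/phi_units; exists u.
by exists u => //; rewrite inE ux.
Qed.

Lemma rank_units_nonunits (A : {set M}) :
  generating A -> rank G + #|A :\: unit_set M| <= #|A|.
Proof.
move=> genA; rewrite -(cardsID (unit_set M) A) leq_add2r -card_preim_units.
exact/rank_le/generating_preim_units.
Qed.

(** The full set of units may be traded for a smallest generating set of the
    group of units. *)
Lemma rank_le_units_add (Y : {set M}) :
  generating (unit_set M :|: Y) -> rank M <= rank G + #|Y|.
Proof.
move=> [_ genY]; have [X [[_ genX] <-]] := minimal_generating_ex (1 : G).
rewrite -(card_imset X phi_inj); apply: leq_trans (leq_card_setU _ _).
apply/rank_le/generated_generating => s.
apply: (generated_morph (f := id)) (genY s) => // a; rewrite !inE => /orP[].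
  move=> /phi_units[u <-]; apply: generated_morph (genX u) => // x Xx.
  by apply: generated_mem; rewrite inE imset_f.
by move=> Ya; apply: generated_mem; rewrite inE Ya orbT.
Qed.

(** The units of a minimal generating set cannot outnumber a smallest
    generating set of the group of units, which could replace them. *)
Lemma card_preim_units_minimal (A : {set M}) :
  minimal_generating A -> #|phi @^-1: A| <= rank G.
Proof.
move=> [genA cardA]; rewrite card_preim_units -(leq_add2r #|A :\: unit_set M|).
rewrite cardsID cardA; apply: rank_le_units_add; apply: generated_generating => s.
apply: (generated_morph (f := id)) (genA.2 s) => // a Aa; apply: generated_mem.
by rewrite !inE Aa andbT orbN.
Qed.

End UnitEmbedding.

Section UnitsVal.
Variable M : finMonoidType.

Lemma val_unitsM : {morph (val : units M -> M) : u v / u * v}.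
Proof. by []. Qed.

Lemma val_unitsP (x : M) : reflect (exists u : units M, val u = x) (is_unit x).
Proof.
by apply: (iffP idP) => [xU|[u <-]]; [exists (Sub x xU) | apply: valP].
Qed.

End UnitsVal.

(** * The kernel of a direct product *)

Section Kernel.
Variable M : finMonoidType.
Implicit Types (I : {set M}) (s x t k a : M).

Lemma ideal_mul I s x t : ideal I -> x \in I -> s * x * t \in I.
Proof.
move=> /andP[_ /'forall_implyP idI] Ix.
have /forallP/(_ s)/andP[/idI/forallP/(_ t)/andP[_ ->] _] // := idI _ Ix.
Qed.

(** The elements [s * a * t] form an ideal, which contains the minimum one. *)
Lemma kernel_mul k a : k \in kernel M -> exists s t, k = s * a * t.
Proof.
pose I := [set x | [exists s, exists t, x == s * a * t]].
have IP x : reflect (exists s t, x = s * a * t) (x \in I).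
  rewrite inE; apply: (iffP existsP) => [[s /existsP[t /eqP]]|[s [t ->]]].
    by exists s, t.
  by exists s; apply/existsP; exists t.
move=> Kk; apply/IP; apply: subsetP Kk; apply: kernel_min.
apply/andP; split; first by apply/set0Pn; exists (1 * a * 1); apply/IP; exists 1, 1.
apply/'forall_implyP => _ /IP[s [t ->]]; apply/forallP => z.
apply/andP; split; apply/IP; first by exists (z * s), t; rewrite !mulgA.
by exists s, (t * z); rewrite !mulgA.
Qed.

End Kernel.

(** An ideal of the product contains some [(a, b)], and [k1], [k2] are multiples
    of [a], [b] by [kernel_mul]. *)
Lemma kernel_pair (M1 M2 : finMonoidType) (k1 : M1) (k2 : M2) :
  k1 \in kernel M1 -> k2 \in kernel M2 -> (k1, k2) \in kernel (M1 * M2)%type.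
Proof.
move=> Kk1 Kk2; apply/bigcapP => I idI.
have /andP[/set0Pn[[a b] Iab] _] := idI.
have [[s1 [t1 ->]] [s2 [t2 ->]]] := (kernel_mul a Kk1, kernel_mul b Kk2).
exact: (@ideal_mul (M1 * M2)%type I (s1, s2) (a, b) (t1, t2)).
Qed.

(** * Slices of a generating set *)

(** Here [p], [q] and [i] stand for the two projections of a direct product and
    the inclusion of one factor; the abstract setting serves both factors. *)
Section Slice.
Variables (M N P : finMonoidType) (p : M -> N) (q : M -> P) (i : N -> M).
Hypotheses (pM : {morph p : x y / x * y}) (qM : {morph q : x y / x * y}).
Hypotheses (iK : cancel i p) (qi : forall s, is_unit (q (i s))).

Definition slice (A : {set M}) := A :&: [set x | ~~ is_unit (p x) & is_unit (q x)].

(** A word for [i s] only uses letters [a] with [q a] a unit. Projected by [p],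
    each of them is a unit of [N] or comes from the slice. *)
Lemma rank_le_slice (A : {set M}) :
  generating A -> rank N <= rank (units N) + #|slice A|.
Proof.
move=> [_ genA]; apply: leq_trans (leq_add (leqnn _) (leq_imset_card p _)).
apply: (rank_le_units_add (@val_unitsM N) val_inj (@val_unitsP N)).
apply: generated_generating => s.
set B := _ :|: _.
suff gen x : generated A x -> is_unit (q x) -> generated B (p x).
  by rewrite -[s]iK; apply: gen.
have mem a : a \in A -> is_unit (q a) -> generated B (p a).
  move=> Aa qa; apply: generated_mem; rewrite !inE -implyNb; apply/implyP => pa.
  by apply: imset_f; rewrite !inE Aa pa.
move: x; apply: generated_ind => // x a Aa IHx.
rewrite qM is_unitM pM => /andP[qx qa].
by apply: generatedM; [apply: IHx | apply: mem].
Qed.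

End Slice.

(** * Generating sets of a direct product *)

Section DirectProduct.
Variables M1 M2 : finMonoidType.
Notation M := (M1 * M2)%type.
Notation U := (units M1 * units M2)%type.

Definition val_pair (u : U) : M := (val u.1, val u.2).

Lemma is_unit_pair (x : M) : is_unit x = is_unit x.1 && is_unit x.2.
Proof.
apply/is_unitP/andP => [[y [xy1 xy2]]|[/is_unitP[y1 e1] /is_unitP[y2 e2]]].
  by split; apply/is_unitP; [exists y.1 | exists y.2].
by exists (y1, y2); congr pair.
Qed.

Lemma val_pairM : {morph val_pair : u v / u * v}.
Proof. by []. Qed.

Lemma val_pair_inj : injective val_pair.
Proof. by move=> [u1 u2] [v1 v2] [/val_inj-> /val_inj->]. Qed.

Lemma val_pairP (x : M) : reflect (exists u, val_pair u = x) (is_unit x).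
Proof.
rewrite is_unit_pair; apply: (iffP andP) => [[]|[u <-]]; last first.
  by split; apply: valP.
by case: x => x1 x2 /= /val_unitsP[u1 <-] /val_unitsP[u2 <-]; exists (u1, u2).
Qed.

Definition inl_mon (x : M1) : M := (x, 1).
Definition inr_mon (y : M2) : M := (1, y).

Lemma inl_monM : {morph inl_mon : x y / x * y}.
Proof. by move=> x y; congr pair; rewrite mulg1. Qed.

Lemma inr_monM : {morph inr_mon : x y / x * y}.
Proof. by move=> x y; congr pair; rewrite mulg1. Qed.

Lemma pair_inl_inr (x1 : M1) (x2 : M2) : (x1, x2) = inl_mon x1 * inr_mon x2.
Proof. by congr pair; rewrite ?mulg1 ?mul1g. Qed.

Lemma is_unit1 (N : finMonoidType) : is_unit (1 : N).
Proof. by have [] := is_unit_monoid_closed N. Qed.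

(** The relative ranks [rank M - rank U] add up; the inequality is written
    without subtraction. The letters (non-unit, unit) and (unit, non-unit) of a
    minimal generating set are disjoint families of non-units, each of them
    large enough for its factor by [rank_le_slice]. *)
Lemma rank_prod_ge :
  rank U + (rank M1 + rank M2) <= rank M + (rank (units M1) + rank (units M2)).
Proof.
have [A [genA cardA]] := minimal_generating_ex (1 : M).
pose s1 := slice (@fst M1 M2) (@snd M1 M2) A.
pose s2 := slice (@snd M1 M2) (@fst M1 M2) A.
have r1 : rank M1 <= rank (units M1) + #|s1|.
  by apply: (@rank_le_slice _ _ _ _ _ inl_mon) => // x; apply: is_unit1.
have r2 : rank M2 <= rank (units M2) + #|s2|.
  by apply: (@rank_le_slice _ _ _ _ _ inr_mon) => // x; apply: is_unit1.
have s12 : #|s1| + #|s2| <= #|A :\: unit_set M|.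
  have s12_0 : s1 :&: s2 = set0.
    by apply/setP => x; rewrite !inE; do 2!case: is_unit; rewrite !andbF.
  rewrite -cardsUI s12_0 cards0 addn0; apply/subset_leq_card/subsetP => x.
  by rewrite !inE is_unit_pair; case: (x \in A); do 2!case: is_unit.
apply: (leq_trans (leq_add (leqnn _) (leq_add r1 r2))).
rewrite addnACA addnA addnAC leq_add2r -cardA.
apply: leq_trans (rank_units_nonunits val_pairM val_pair_inj val_pairP genA).
by rewrite leq_add2l.
Qed.

Lemma prod_generating (X1 : {set units M1}) (X2 : {set units M2}) :
  generating X1 -> generating X2 ->
  generating ((fun u => (u, 1) : U) @: X1 :|: (fun u => (1, u) : U) @: X2).
Proof.
move=> genX1 genX2; set X := _ :|: _.
apply: generated_generating => -[u1 u2].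
have -> : (u1, u2) = (u1, 1) * (1, u2) :> U by congr pair; rewrite ?mulg1 ?mul1g.
apply: generatedM.
  apply: (generated_morph (f := fun u => (u, 1) : U)) (genX1.2 u1) => [u v|u Xu].
    by congr pair; rewrite mulg1.
  by apply/generated_mem/setUP; left; apply: imset_f.
apply: (generated_morph (f := fun u => (1, u) : U)) (genX2.2 u2) => [u v|u Xu].
  by congr pair; rewrite mulg1.
by apply/generated_mem/setUP; right; apply: (imset_f (fun u => (1, u) : U)).
Qed.

Section JoinedGenerators.
Variables (A1 : {set M1}) (A2 : {set M2}) (X : {set U}).
Hypotheses (minA1 : minimal_generating A1) (minA2 : minimal_generating A2).
Hypotheses (genX : generating X) (cardX : #|X| <= rank U).

Definition joined : {set M} := val_pair @: X :|:
  (inl_mon @: (A1 :\: unit_set M1) :|: inr_mon @: (A2 :\: unit_set M2)).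

Lemma joined_units x : x \in X -> val_pair x \in joined.
Proof. by move=> Xx; rewrite inE imset_f. Qed.

Lemma joined_inl a : a \in A1 -> ~~ is_unit a -> inl_mon a \in joined.
Proof. by move=> Aa nUa; rewrite in_setU in_setU imset_f ?orbT // !inE nUa. Qed.

Lemma joined_inr a : a \in A2 -> ~~ is_unit a -> inr_mon a \in joined.
Proof. by move=> Aa nUa; rewrite in_setU in_setU (imset_f inr_mon) ?orbT // !inE nUa. Qed.

(** Every element is [(x1, 1) * (1, x2)], and each factor is spelled by letters
    of [A1] or [A2], whose unit letters are words over [X]. *)
Lemma joined_generating : generating joined.
Proof.
have gU u : generated joined (val_pair u).
  apply: generated_morph (genX.2 u) => // x Xx.
  exact/generated_mem/joined_units.
apply: generated_generating => -[x1 x2]; rewrite pair_inl_inr.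
apply: generatedM.
  apply: generated_morph (minA1.1.2 x1) => [|a Aa]; first exact: inl_monM.
  have [/val_unitsP[u <-]|nUa] := boolP (is_unit a); first exact: gU (u, 1).
  exact/generated_mem/joined_inl.
apply: generated_morph (minA2.1.2 x2) => [|a Aa]; first exact: inr_monM.
have [/val_unitsP[u <-]|nUa] := boolP (is_unit a); first exact: gU (1, u).
exact/generated_mem/joined_inr.
Qed.

(** The non-units of [A1] and [A2] number exactly the relative ranks of the
    factors, and [rank_prod_ge] shows that the product needs as many. *)
Lemma joined_minimal : minimal_generating joined.
Proof.
split; first exact: joined_generating.
apply/eqP; rewrite eqn_leq (rank_le joined_generating) andbT.
have [[gen1 card1] [gen2 card2]] := (minA1, minA2).
have r1 := rank_units_nonunits (@val_unitsM M1) val_inj (@val_unitsP M1) gen1.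
have r2 := rank_units_nonunits (@val_unitsM M2) val_inj (@val_unitsP M2) gen2.
rewrite -(leq_add2r (rank (units M1) + rank (units M2))).
apply: leq_trans rank_prod_ge; rewrite -card1 -card2.
apply: leq_trans (leq_add (leqnn _) (leq_add r1 r2)).
rewrite addnACA [X in _ <= X]addnA addnC [X in _ <= X]addnAC.
rewrite [X in _ <= X]addnC leq_add2l.
apply: leq_trans (leq_card_setU _ _) _; apply: leq_add.
  exact: leq_trans (leq_imset_card _ _) cardX.
by apply: leq_trans (leq_card_setU _ _) (leq_add _ _); apply: leq_imset_card.
Qed.

(** The assumption [0 < c] pays for the non-unit letters, each of which is a
    single generator of the product. *)
Lemma len_joined c k1 k2 : 0 < c ->
    (forall u, val u \in A1 -> len X (u, 1) <= c) ->
    (forall u, val u \in A2 -> len X (1, u) <= c) ->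
  len joined (k1, k2) <= ((len A1 k1 + len A2 k2) * c)%N.
Proof.
move=> c_gt0 X1 X2; have genJ := joined_generating.
have lenU u : len joined (val_pair u) <= len X u.
  rewrite -[X in _ <= X]muln1; apply: len_morph => // x Xx.
  exact/len_mem/joined_units.
rewrite pair_inl_inr mulnDl; apply: leq_trans (lenM _ _ genJ) (leq_add _ _).
  apply: len_morph => //; [exact: inl_monM | exact: minA1.1 | move=> a Aa].
  have [/val_unitsP[u ua]|nUa] := boolP (is_unit a).
    by rewrite -ua; apply: leq_trans (lenU (u, 1)) (X1 _ _); rewrite ua.
  exact: leq_trans (len_mem (joined_inl Aa nUa)) c_gt0.
apply: len_morph => //; [exact: inr_monM | exact: minA2.1 | move=> a Aa].
have [/val_unitsP[u ua]|nUa] := boolP (is_unit a).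
  by rewrite -ua; apply: leq_trans (lenU (1, u)) (X2 _ _); rewrite ua.
exact: leq_trans (len_mem (joined_inr Aa nUa)) c_gt0.
Qed.

End JoinedGenerators.

Lemma min_ker_length_prod_le c (A1 : {set M1}) (A2 : {set M2}) (X : {set U}) k1 k2 :
    minimal_generating A1 -> minimal_generating A2 ->
    generating X -> #|X| <= rank U -> 0 < c ->
    (forall u, val u \in A1 -> len X (u, 1) <= c) ->
    (forall u, val u \in A2 -> len X (1, u) <= c) ->
    k1 \in kernel M1 -> k2 \in kernel M2 ->
  min_ker_length M <= ((len A1 k1 + len A2 k2) * c)%N.
Proof.
move=> minA1 minA2 genX cardX c_gt0 X1 X2 Kk1 Kk2.
apply: leq_trans (len_joined minA1 minA2 genX k1 k2 c_gt0 X1 X2).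
exact: min_ker_length_le (joined_minimal minA1 minA2 genX cardX) (kernel_pair Kk1 Kk2).
Qed.

End DirectProduct.

Local Close Scope group_scope.

Theorem theorem4p7 (M1 M2 : finMonoidType) :
  (min_diam (units M1 * units M2)%type <> 0 ->
     min_ker_length (M1 * M2)%type
       <= (min_ker_length M1 + min_ker_length M2)
          * min_diam (units M1 * units M2)%type)
  /\
  (rank (units M1 * units M2)%type = rank (units M1) + rank (units M2) \/
   min_diam (units M1 * units M2)%type = 0 ->
     min_ker_length (M1 * M2)%type
       <= min_ker_length M1 + min_ker_length M2).
Proof.
have [A1 [k1 [minA1 Kk1 <-]]] := min_ker_length_attained (1 : M1)%g.
have [A2 [k2 [minA2 Kk2 <-]]] := min_ker_length_attained (1 : M2)%g.
have [X [genX cardX] diamX] := min_diam_attained (units M1 * units M2)%type.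
have diam_bound c : 0 < c -> min_diam (units M1 * units M2)%type <= c ->
    min_ker_length (M1 * M2)%type <= (len A1 k1 + len A2 k2) * c.
  rewrite -diamX => c_gt0 Dc.
  have lenX u : len X u <= c by apply: leq_trans Dc; apply: leq_bigmax.
  by apply: (min_ker_length_prod_le (X := X)); rewrite ?cardX.
split=> [/eqP|]; first by rewrite -lt0n => D_gt0; apply: diam_bound.
(* The last two cases are both instances of the letter bound c = 1. *)
rewrite -[X in _ -> _ <= X]muln1 => -[rankU|D0]; last first.
  by apply: diam_bound; rewrite ?D0.
pose X1 := val @^-1: A1 : {set units M1}.
pose X2 := val @^-1: A2 : {set units M2}.
have genX1 : generating X1.
  exact: (generating_preim_units (@val_unitsM M1) val_inj (@val_unitsP M1) minA1.1).
have genX2 : generating X2.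
  exact: (generating_preim_units (@val_unitsM M2) val_inj (@val_unitsP M2) minA2.1).
apply: (min_ker_length_prod_le minA1 minA2 (prod_generating genX1 genX2)) => //.
- rewrite rankU; apply: leq_trans (leq_card_setU _ _) (leq_add _ _).
    apply: leq_trans (leq_imset_card _ _) _.
    exact: (card_preim_units_minimal (@val_unitsM M1) val_inj (@val_unitsP M1) minA1).
  apply: leq_trans (leq_imset_card _ _) _.
  exact: (card_preim_units_minimal (@val_unitsM M2) val_inj (@val_unitsP M2) minA2).
- by move=> u Au; apply/len_mem/setUP; left; apply/imsetP; exists u; rewrite ?inE.
- by move=> u Au; apply/len_mem/setUP; right; apply/imsetP; exists u; rewrite ?inE.
Qed.
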